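(* Let $M\in\mathbb{R}^{m\times n}_+$ and $r\ge1$. For every constant $\epsilon>0$, the limit points of the block coordinate descent algorithm (described in the context) initialized with positive matrices and applied to the optimization problem $$\min_{V\ge\epsilon,\;W\ge\epsilon}\ \|M-VW\|_F^2,\qquad V\in\mathbb{R}^{m\times r},\ W\in\mathbb{R}^{r\times n},$$ are stationary points of this problem.
   Context: Inequalities and maxima are entrywise. $V_{:k}$ denotes the $k$-th column of $V$ and $W_{k:}$ the $k$-th row of $W$; $R_k=M-\sum_{i\neq k}V_{:i}W_{i:}$ is the $k$-th residual matrix, so $\|M-VW\|_F=\|R_k-V_{:k}W_{k:}\|_F$. The block coordinate descent algorithm (Hierarchical Alternating Least Squares with lower bound $\epsilon$) has as blocks of variables the $r$ columns of $V$ and the $r$ rows of $W$; it updates the blocks one at a time in some fixed cyclic order, each block being replaced by the minimizer of the objective over that block with all other blocks fixed at their current values: $$V_{:k}\leftarrow\mathrm{argmin}_{V_{:k}\ge\epsilon}\|R_k-V_{:k}W_{k:}\|_F^2=\max\Big(\epsilon,\frac{R_kW_{k:}^T}{\|W_{k:}\|_2^2}\Big),\qquad W_{k:}\leftarrow\mathrm{argmin}_{W_{k:}\ge\epsilon}\|R_k-V_{:k}W_{k:}\|_F^2=\max\Big(\epsilon,\frac{V_{:k}^TR_k}{\|V_{:k}\|_2^2}\Big).$$ A limit point is the limit of a convergent subsequence of the iterates. A stationary point is a point satisfying the first-order (KKT) conditions of the problem: with $f(V,W)=\|M-VW\|_F^2$, one has $V\ge\epsilon$, $\nabla_Vf\ge\mathbf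 0$, $(V_{ik}-\epsilon)(\nabla_Vf)_{ik}=0$ for all $i,k$, and likewise for $W$. *)

(* Defs.v *)
From HB Require Import structures.
From mathcomp Require Import all_boot all_order all_algebra.
From mathcomp Require Import all_classical all_reals all_analysis.

Set Implicit Arguments.
Unset Strict Implicit.
Unset Printing Implicit Defensive.

Import Order.TTheory GRing.Theory Num.Theory numFieldNormedType.Exports.

Local Open Scope classical_set_scope.
Local Open Scope ring_scope.

Section Defs.
Variable R : realType.

Definition entrywise_ge (eps : R) (p q : nat) (A : 'M[R]_(p, q)) : Prop :=
  forall i j, eps <= A i j.

Definition entrywise_gt (eps : R) (p q : nat) (A : 'M[R]_(p, q)) : Prop :=
  forall i j, eps < A i j.

(* The library norm `|A| on matrices is the maximum norm, hence this one. *)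
Definition frobenius_norm (p q : nat) (A : 'M[R]_(p, q)) : R :=
  Num.sqrt (\sum_i \sum_j A i j ^+ 2).

Definition is_argmin (T : Type) (S : set T) (g : T -> R) (a : T) : Prop :=
  S a /\ forall b, S b -> g a <= g b.

(* The matrix of partial derivatives; delta_mx i j is the (i, j) unit matrix. *)
Definition gradient (p q : nat) (g : 'M[R]_(p, q) -> R) (A : 'M[R]_(p, q)) :
    'M[R]_(p, q) :=
  \matrix_(i, j) 'D_(delta_mx i j) g A.

Section NMF.
Variables m n r : nat.
Implicit Types (M : 'M[R]_(m, n)) (V : 'M[R]_(m, r)) (W : 'M[R]_(r, n)).

Definition nmf_objective M V W : R := frobenius_norm (M - V *m W) ^+ 2.

Definition nmf_residual M V W (k : 'I_r) : 'M[R]_(m, n) :=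
  M - \sum_(i | i != k) col i V *m row i W.

(* inl k stands for the k-th column of V, inr k for the k-th row of W. *)
Definition nmf_block : Type := ('I_r + 'I_r)%type.

(* (V', W') is obtained from (V, W) by minimizing over the block b alone.
   When m, n > 0 and the vector multiplying the block is nonzero, the minimizer
   is unique, so that (V', W') is then determined by (V, W). *)
Definition hals_update M (eps : R) (b : nmf_block)
    (VW VW' : 'M[R]_(m, r) * 'M[R]_(r, n)) : Prop :=
  let: (V, W) := VW in
  let: (V', W') := VW' in
  match b with
  | inl k =>
      [/\ W' = W,
          forall l, l != k -> col l V' = col l V &
          is_argmin [set v : 'cV[R]_m | entrywise_ge eps v]
            (fun v => frobenius_norm
               (nmf_residual M V W k - v *m row k W) ^+ 2)
            (col k V')]
  | inr k =>
      [/\ V' = V,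
          forall l, l != k -> row l W' = row l W &
          is_argmin [set w : 'rV[R]_n | entrywise_ge eps w]
            (fun w => frobenius_norm
               (nmf_residual M V W k - col k V *m w) ^+ 2)
            (row k W')]
  end.

(* A sequence of blocks with period r + r, the number of blocks; since every
   block occurs in the first period, it occurs there exactly once. *)
Definition cyclic_order (order : nat -> nmf_block) : Prop :=
  (forall t, order (t + (r + r))%N = order t) /\
  (forall b, exists2 t, (t < r + r)%N & order t = b).

(* x t is the iterate after t single-block updates. *)
Definition hals_iterates M (eps : R) (order : nat -> nmf_block)
    (x : nat -> 'M[R]_(m, r) * 'M[R]_(r, n)) : Prop :=
  [/\ entrywise_gt 0 (x 0%N).1, entrywise_gt 0 (x 0%N).2 &
      forall t, hals_update M eps (order t) (x t) (x t.+1)].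

Definition stationary_point M (eps : R) V W : Prop :=
  let gV := gradient (fun V' => nmf_objective M V' W) V in
  let gW := gradient (fun W' => nmf_objective M V W') W in
  [/\ entrywise_ge eps V, entrywise_ge 0 gV &
      forall i k, (V i k - eps) * gV i k = 0] /\
  [/\ entrywise_ge eps W, entrywise_ge 0 gW &
      forall k j, (W k j - eps) * gW k j = 0].

End NMF.

Definition subsequential_limit (T : topologicalType) (x : nat -> T) (p : T) : Prop :=
  exists phi : nat -> nat,
    {homo phi : s t / (s < t)%N} /\ (x \o phi) @ \oo --> p.

End Defs.

(* Main.v *)
(* Once every block has been updated, all entries are at least eps, so that the
   objective restricted to a block is a separable quadratic with curvature at
   least eps ^ 2 (when m, n > 0; otherwise the objective vanishes identically).
   Each update therefore decreases the objective by at least eps ^ 2 times the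
   squared length of the step, and since the objective is bounded below the
   steps tend to 0.  Given a subsequence converging to (V, W), moving each index
   forward to the next update of a block b, which is a bounded distance away,
   yields another sequence with the same limit, along which the KKT conditions
   of block b hold exactly; they pass to the limit by continuity.  Rows of W are
   handled as columns of W^T, by transposing the whole problem. *)
Require Import Defs.
From HB Require Import structures.
From mathcomp Require Import all_boot all_order all_algebra.
From mathcomp Require Import all_classical all_reals all_analysis.
From mathcomp Require Import ring lra zify.

Import Order.TTheory GRing.Theory Num.Theory numFieldNormedType.Exports.

Local Open Scope classical_set_scope.
Local Open Scope ring_scope.

Set Implicit Arguments.
Unset Strict Implicit.

Section Convergence.
Context {R : realType}.

(** For a small step against the sign of [g] the linear term beats the quadratic one. Downward steps
    are limited only by the distance [a] to the bound, so [g] can be positive only when [a = 0]. *)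
Lemma complementary_slackness_of_quadratic_ge0 (a g c : R) : 0 <= a -> 0 <= c ->
  (forall t, - a <= t -> 0 <= t * g + t ^+ 2 * c) -> 0 <= g /\ a * g = 0.
Proof.
move=> a_ge0 c_ge0 ge0_quad.
have c1_gt0 : 0 < c + 1 by lra.
have g_ge0 : 0 <= g.
  rewrite leNgt; apply/negP => g_lt0.
  (* At this [t] the quadratic equals [- t ^+ 2]; dividing by [c + 1] rather than [c] covers
     [c = 0]. *)
  pose t := - g / (c + 1).
  have t_gt0 : 0 < t by rewrite divr_gt0 // oppr_gt0.
  have tE : t * (c + 1) = - g by rewrite mulfVK // gt_eqF.
  have := ge0_quad t ltac:(lra).
  have -> : t * g + t ^+ 2 * c = - t ^+ 2.
    have -> : g = - (t * (c + 1)) by rewrite tE opprK.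
    ring.
  by rewrite oppr_ge0 leNgt exprn_gt0.
split=> //.
have [a_gt0|a_le0] := ltP 0 a; last first.
  by have -> : a = 0 by [apply/eqP; rewrite eq_le a_le0]; rewrite mul0r.
have [g_gt0|g_le0] := ltP 0 g; last first.
  by have -> : g = 0 by [apply/eqP; rewrite eq_le g_le0]; rewrite mulr0.
(* The cap [a] keeps [- t] admissible, and [t * (c + 1) <= g] makes the value at [- t] at most
   [- t ^+ 2]. *)
pose t := Num.min a (g / (c + 1)).
have t_gt0 : 0 < t by rewrite lt_min a_gt0 divr_gt0.
have t_le : t * (c + 1) <= g by rewrite -ler_pdivlMr // ge_min lexx orbT.
have t_lea : t <= a by rewrite ge_min lexx.
have := ge0_quad (- t) ltac:(lra).
have -> : - t * g + (- t) ^+ 2 * c = t * (t * (c + 1) - g - t) by ring.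
by rewrite pmulr_rge0 //; lra.
Qed.

(** Closed form of the gradient in the left factor; at [M^T], [W^T], [V^T] it is the transpose of
    the gradient in [W]. *)
Definition objective_gradient {m n r : nat} (M : 'M[R]_(m, n)) V W :
    'M[R]_(m, r) :=
  2 *: ((V *m W - M) *m W^T).

Definition column_kkt {m n r : nat} (M : 'M[R]_(m, n)) eps
    (V : 'M[R]_(m, r)) (W : 'M[R]_(r, n)) (k : 'I_r) :=
  forall i, [/\ eps <= V i k, 0 <= objective_gradient M V W i k
    & (V i k - eps) * objective_gradient M V W i k = 0].

(** * The objective as a function of one column, and column updates *)

Section Columns.
Context {m n r : nat}.
Variable M : 'M[R]_(m, n).
Implicit Types (V : 'M[R]_(m, r)) (W : 'M[R]_(r, n)) (k : 'I_r) (u : 'cV[R]_m).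

Lemma frobenius_norm_sqr p q (A : 'M[R]_(p, q)) :
  frobenius_norm A ^+ 2 = \sum_i \sum_j A i j ^+ 2.
Proof.
rewrite sqr_sqrtr // sumr_ge0 // => i _; rewrite sumr_ge0 // => j _.
exact: sqr_ge0.
Qed.

Lemma frobenius_norm_trmx p q (A : 'M[R]_(p, q)) :
  frobenius_norm A^T = frobenius_norm A.
Proof.
rewrite /frobenius_norm exchange_big /=; congr Num.sqrt.
by apply: eq_bigr => i _; apply: eq_bigr => j _; rewrite mxE.
Qed.

Lemma nmf_objective_trmx V W :
  nmf_objective M^T W^T V^T = nmf_objective M V W.
Proof. by rewrite /nmf_objective -trmx_mul -linearB /= frobenius_norm_trmx. Qed.

(** Exact second-order expansion: every entry of the column has the same curvature, the squared norm
    of row [k] of [W], and there are no cross terms. *)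
Lemma nmf_objective_add_column V W k u :
  nmf_objective M (V + u *m delta_mx 0 k) W =
  nmf_objective M V W + \sum_i u i 0 * objective_gradient M V W i k
    + (\sum_i u i 0 ^+ 2) * (\sum_j W k j ^+ 2).
Proof.
rewrite /nmf_objective !frobenius_norm_sqr mulr_suml -!big_split /=.
apply: eq_bigr => i _; rewrite !mxE !mulr_sumr -!big_split /=.
apply: eq_bigr => j _; rewrite mulmxDl -mulmxA -rowE !mxE big_ord1 !mxE; ring.
Qed.

Lemma nmf_objective_add_delta V W i k h :
  nmf_objective M (V + h *: delta_mx i k) W =
  nmf_objective M V W + h * objective_gradient M V W i k
    + h ^+ 2 * \sum_j W k j ^+ 2.
Proof.
have -> : h *: delta_mx i k = (h *: delta_mx i 0) *m delta_mx (0 : 'I_1) k.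
  by rewrite -scalemxAl mul_delta_mx.
rewrite nmf_objective_add_column; congr (_ + _ + _ * _).
  rewrite (bigD1 i) //= big1 => [|l li].
    by rewrite !mxE !eqxx mulr1 addr0.
  by rewrite !mxE (negPf li) mulr0 mul0r.
rewrite (bigD1 i) //= big1 => [|l li].
  by rewrite !mxE !eqxx mulr1 addr0.
by rewrite !mxE (negPf li) mulr0 expr0n.
Qed.

Lemma mulmx_sum_col_row V W : V *m W = \sum_k col k V *m row k W.
Proof.
apply/matrixP => i j; rewrite summxE mxE; apply: eq_bigr => k _.
by rewrite mxE big_ord1 !mxE.
Qed.

Lemma eq_add_column V V' k : (forall l, l != k -> col l V' = col l V) ->
  V = V' + (col k V - col k V') *m delta_mx 0 k.
Proof.
move=> eqV; apply/matrixP => i l; rewrite !mxE big_ord1 !mxE eqxx /=.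
have [->|lk] := eqVneq l k; first by rewrite mulr1 addrC subrK.
by have /matrixP/(_ i 0) := eqV _ lk; rewrite !mxE mulr0 addr0.
Qed.

(** Carries minimality over from the residual to the full objective, in the form to which the
    expansion applies. *)
Lemma hals_update_column eps V V' W W' k :
  hals_update M eps (inl k) (V, W) (V', W') ->
  forall v, entrywise_ge eps v ->
  nmf_objective M V' W <=
  nmf_objective M (V' + (v - col k V') *m delta_mx 0 k) W.
Proof.
move=> [_ eqV [_ minV]] v v_ge.
suff residualE u : nmf_residual M V W k - u *m row k W =
    M - (V' + (u - col k V') *m delta_mx 0 k) *m W.
  have := minV _ v_ge; rewrite !residualE subrr mul0mx addr0.
  exact.
rewrite mulmxDl -mulmxA -rowE mulmxBl (mulmx_sum_col_row V') (bigD1 k) //=.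
rewrite (eq_bigr (fun l => col l V *m row l W)) => [|l lk]; last by rewrite eqV.
rewrite /nmf_residual; move: (\sum_(_ | _) _) (col k V' *m _) (u *m _) => S A B.
by apply/matrixP => i j; rewrite !mxE; ring.
Qed.

Lemma hals_update_column_kkt eps V V' W W' k :
  hals_update M eps (inl k) (V, W) (V', W') -> column_kkt M eps V' W' k.
Proof.
move=> upd; have := hals_update_column upd.
case: upd => -> _ [V'_ge _] minV' i.
have {}V'_ge l : eps <= V' l k by have := V'_ge l 0; rewrite mxE.
have [|||? ?] := @complementary_slackness_of_quadratic_ge0 (V' i k - eps)
  (objective_gradient M V' W i k) (\sum_j W k j ^+ 2).
- by rewrite subr_ge0.
- by apply: sumr_ge0 => j _; rewrite sqr_ge0.
(* Only entry [i] moves, and [t_ge] is what keeps it at least [eps]. *)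
- move=> t t_ge; have := minV' (col k V' + t *: delta_mx i 0).
  rewrite addrAC subrr add0r -scalemxAl mul_delta_mx nmf_objective_add_delta.
  rewrite -addrA lerDl; apply=> l j.
  rewrite !mxE ord1 eqxx andbT; case: eqVneq => [->|_].
    by rewrite mulr1; lra.
  by rewrite mulr0 addr0.
by [].
Qed.

(** Expanding around the new point [V'] makes the linear term nonnegative, since the KKT conditions
    hold at [V'] and the old column is feasible. The quadratic term remains as guaranteed
    decrease. *)
Lemma hals_update_column_decrease eps V V' W W' k :
  hals_update M eps (inl k) (V, W) (V', W') -> (forall i, eps <= V i k) ->
  nmf_objective M V' W' +
    (\sum_i (V i k - V' i k) ^+ 2) * (\sum_j W k j ^+ 2) <= nmf_objective M V W.
Proof.
move=> upd V_ge; have kkt := hals_update_column_kkt upd.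
case: upd => W'E eqV _; rewrite {}W'E in kkt *.
rewrite [X in _ <= nmf_objective _ X _](eq_add_column eqV).
rewrite nmf_objective_add_column.
rewrite (eq_bigr (fun i => (col k V - col k V') i 0 ^+ 2)) => [|i _];
  last by rewrite !mxE.
rewrite lerD2r lerDl sumr_ge0 // => i _.
case: (kkt i) => _ g_ge0 compl.
have -> : (col k V - col k V') i 0 = (V i k - eps) - (V' i k - eps).
  by rewrite !mxE; ring.
by rewrite mulrBl compl subr0 mulr_ge0 // subr_ge0.
Qed.

Lemma hals_update_trmx eps V V' W W' k :
  hals_update M eps (inr k) (V, W) (V', W') ->
  hals_update M^T eps (inl k) (W^T, V^T) (W'^T, V'^T).
Proof.
have residualE w : nmf_residual M^T W^T V^T k - w *m row k V^T =
    (nmf_residual M V W k - col k V *m w^T)^T.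
  rewrite /nmf_residual [RHS]linearB /= [in RHS]linearB /=.
  rewrite trmx_mul trmxK tr_col.
  congr (_ - _ - _); rewrite linear_sum /=.
  by apply: eq_bigr => l _; rewrite trmx_mul tr_row tr_col.
move=> [-> eqW [W'_ge minW]]; split=> // [l lk|].
  by rewrite -!tr_row eqW.
split=> [i j|w w_ge]; first by rewrite -tr_row mxE.
rewrite !residualE !frobenius_norm_trmx -tr_row trmxK; apply: minW => i j.
by rewrite mxE.
Qed.

End Columns.

(** * Identification of the gradients *)

Lemma derive_of_quadratic_expansion p q (g : 'M[R]_(p, q) -> R) A D (a c : R) :
  (forall h, g (A + h *: D) = g A + h * a + h ^+ 2 * c) -> 'D_D g A = a.
Proof.
move=> gE; rewrite /derive; apply: cvg_lim; first exact: Rhausdorff.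
(* For [h != 0] the difference quotient is exactly [a + h * c]. *)
have near_eq : \forall h \near (0 : R)^',
    a + h * c = h^-1 *: ((g \o shift A) (h *: D) - g A).
  near=> h; have h_neq0 : h != 0 by near: h; exact: nbhs_dnbhs_neq.
  rewrite /= [h *: D + A]addrC gE.
  have -> : g A + h * a + h ^+ 2 * c - g A = h * (a + h * c) by ring.
  by rewrite /GRing.scale /= mulKf.
apply: cvg_trans; first exact: near_eq_cvg near_eq.
apply: (@cvg_within_filter _ _ _ (nbhs (0 : R))).
have : a + h * c @[h --> (0 : R)] --> a + 0 * c.
  by apply: cvgD; [exact: cvg_cst|apply: cvgMr_tmp; exact: cvg_id].
by rewrite mul0r addr0.
Unshelve. all: by end_near.
Qed.

Lemma gradient_objective_left m n r (M : 'M[R]_(m, n)) (V : 'M[R]_(m, r)) W :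
  gradient (fun V' => nmf_objective M V' W) V = objective_gradient M V W.
Proof.
apply/matrixP => i k; rewrite mxE.
apply: (@derive_of_quadratic_expansion _ _ _ _ _ _ (\sum_j W k j ^+ 2)) => h.
exact: nmf_objective_add_delta.
Qed.

Lemma gradient_objective_right m n r (M : 'M[R]_(m, n)) V (W : 'M[R]_(r, n)) :
  gradient (nmf_objective M V) W = (objective_gradient M^T W^T V^T)^T.
Proof.
apply/matrixP => k j; rewrite mxE [RHS]mxE.
apply: (@derive_of_quadratic_expansion _ _ _ _ _ _ (\sum_i V^T k i ^+ 2)) => h.
rewrite -!(nmf_objective_trmx M) linearD linearZ /= trmx_delta.
exact: nmf_objective_add_delta.
Qed.


(** * Real sequences with vanishing steps *)

Lemma cvg_sqr0 (u : nat -> R) :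
  u n ^+ 2 @[n --> \oo] --> 0 -> u n @[n --> \oo] --> 0.
Proof.
move=> u2_0; apply: norm_cvg0.
have : Num.sqrt (u n ^+ 2) @[n --> \oo] --> Num.sqrt (0 : R).
  by apply: continuous_cvg => //; exact: sqrt_continuous.
by rewrite sqrtr0; under eq_fun do rewrite sqrtr_sqr.
Qed.

(** From index [N] on, [f] is nonincreasing and bounded below, so it converges; its decrements tend
    to 0 and dominate [c] times the squared steps. *)
Lemma step_cvg0_of_decrease (f u : nat -> R) (c : R) (N : nat) :
  0 < c -> (forall t, 0 <= f t) ->
  (forall t, (N <= t)%N -> f t.+1 + c * (u t - u t.+1) ^+ 2 <= f t) ->
  u t - u t.+1 @[t --> \oo] --> 0.
Proof.
move=> c_gt0 f_ge0 decr; apply: cvg_sqr0; rewrite -(cvg_shiftn N) /=.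
pose g t := f (t + N)%N.
have decrg t : c * (u (t + N)%N - u (t + N).+1) ^+ 2 <= g t - g t.+1.
  by rewrite lerBrDl; apply: decr; rewrite leq_addl.
have /cvg_ex[l gl] : cvgn g.
  apply: nonincreasing_is_cvgn; last by exists 0 => _ [t _ <-]; exact: f_ge0.
  apply/nonincreasing_seqP => t; rewrite -subr_ge0 (le_trans _ (decrg t)) //.
  by rewrite mulr_ge0 ?sqr_ge0 // ltW.
have diff0 : c^-1 * (g t - g t.+1) @[t --> \oo] --> 0.
  rewrite -(mulr0 c^-1) -(subrr l); apply: cvgMl_tmp; apply: cvgB => //.
  by rewrite cvg_shiftS.
apply: squeeze_cvgr (cvg_cst 0) diff0; near=> t; rewrite sqr_ge0 /=.
by rewrite ler_pdivlMl.
Unshelve. all: by end_near.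
Qed.

(** The two subsequences differ by at most [K] consecutive steps of [u], a bounded number of
    vanishing terms. *)
Lemma cvg_nearby_subsequence (u : nat -> R) (phi psi : nat -> nat) (K : nat)
    (l : R) :
  u t - u t.+1 @[t --> \oo] --> 0 ->
  phi s @[s --> \oo] --> \oo -> (forall s, (phi s <= psi s <= phi s + K)%N) ->
  u (phi s) @[s --> \oo] --> l -> u (psi s) @[s --> \oo] --> l.
Proof.
move=> step0 phi_oo psi_near uphi.
pose bound s := \sum_(j < K) `|u (phi s + j)%N - u (phi s + j).+1|.
have bound0 : bound s @[s --> \oo] --> 0.
  have -> : (0 : R) = \sum_(j < K) 0 by rewrite big1.
  apply: (cvg_big _ _ (x0 := 0 : R)) => [|j _]; first exact: add_continuous.
  rewrite -(@normr0 _ R); apply: cvg_norm.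
  apply: (cvg_comp (fun s => phi s + j)%N (fun t => u t - u t.+1)) step0.
  exact: cvg_comp phi_oo (cvg_addnr j).
have dist_le s : `|u (phi s) - u (psi s)| <= bound s.
  have /andP[le_psi psi_le] := psi_near s.
  rewrite -(subnKC le_psi); have : (psi s - phi s <= K)%N by rewrite leq_subLR.
  rewrite /bound.
  (* Induction on [K] for all distances [d <= K]: only the maximal [d] needs the last summand, by
     the triangle inequality. *)
  elim: K {psi_near bound bound0 psi_le} (psi s - phi s)%N => [|k IHk] d.
    by rewrite leqn0 => /eqP ->; rewrite addn0 subrr normr0 big_ord0.
  rewrite leq_eqVlt ltnS => /predU1P[->|dk].
    rewrite big_ord_recr addnS /=.
    apply: (le_trans (ler_distD (u (phi s + k)%N) _ _)).
    by rewrite lerD2r IHk.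
  by rewrite big_ord_recr /= ler_wpDr // IHk.
have diff0 : u (phi s) - u (psi s) @[s --> \oo] --> 0.
  apply: norm_cvg0; apply: squeeze_cvgr (cvg_cst 0) bound0; near=> s.
  by rewrite normr_ge0 dist_le.
rewrite -[l]subr0.
have -> : (fun s => u (psi s)) = (fun s => u (phi s) - (u (phi s) - u (psi s))).
  by apply/funext => s; rewrite subKr.
exact: cvgB uphi diff0.
Unshelve. all: by end_near.
Qed.


(** The gradient is polynomial in the entries of both factors, so the KKT conditions are closed. *)
Lemma column_kkt_lim m n r (M : 'M[R]_(m, n)) eps (k : 'I_r)
    (Vs : nat -> 'M[R]_(m, r)) (Ws : nat -> 'M[R]_(r, n))
    (V : 'M[R]_(m, r)) (W : 'M[R]_(r, n)) :
  (forall s, column_kkt M eps (Vs s) (Ws s) k) ->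
  (forall i l, Vs s i l @[s --> \oo] --> V i l) ->
  (forall l j, Ws s l j @[s --> \oo] --> W l j) ->
  column_kkt M eps V W k.
Proof.
move=> kkt VsV WsW i.
have grad_cvg : objective_gradient M (Vs s) (Ws s) i k @[s --> \oo] -->
    objective_gradient M V W i k.
  under eq_fun do rewrite !mxE; rewrite !mxE; apply: cvgMl_tmp.
  apply: (cvg_big _ _ (x0 := 0 : R)) => [|j _]; first exact: add_continuous.
  under eq_fun do rewrite !mxE; rewrite !mxE; apply: cvgM; last exact: WsW.
  apply: cvgB; last exact: cvg_cst.
  apply: (cvg_big _ _ (x0 := 0 : R)) => [|l _]; first exact: add_continuous.
  by apply: cvgM; [exact: VsV|exact: WsW].
split.
- rewrite -(cvg_lim _ (VsV i k)) //; apply: limr_ge.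
    by apply/cvg_ex; exists (V i k).
  by near=> s; case: (kkt s i).
- rewrite -(cvg_lim _ grad_cvg) //; apply: limr_ge.
    by apply/cvg_ex; exists (objective_gradient M V W i k).
  by near=> s; case: (kkt s i).
- apply: (@cvg_unique _ (@Rhausdorff R) ((fun=> 0) @ \oo)); last exact: cvg_cst.
  have -> : (fun=> 0) =
      fun s => (Vs s i k - eps) * objective_gradient M (Vs s) (Ws s) i k.
    by apply/funext => s; case: (kkt s i).
  by apply: cvgM grad_cvg; apply: cvgB; [exact: VsV|exact: cvg_cst].
Unshelve. all: by end_near.
Qed.

(** An index [i] forces [0 < m], hence [n = 0], and the gradient is a multiple of an empty sum. *)
Lemma column_kkt_of_empty m n r (M : 'M[R]_(m, n)) eps
    (V : 'M[R]_(m, r)) W (k : 'I_r) :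
  ~~ ((0 < m)%N && (0 < n)%N) -> (forall i, eps <= V i k) ->
  column_kkt M eps V W k.
Proof.
move=> mn0 V_ge i; have m_gt0 : (0 < m)%N by case: m i {mn0 M V V_ge} => [[]|].
have n0 : n = 0%N by apply/eqP; rewrite -leqn0 leqNgt; rewrite m_gt0 in mn0.
suff -> : objective_gradient M V W i k = 0 by rewrite mulr0.
by rewrite !mxE big1 ?mulr0 // => j; have := ltn_ord j; rewrite {2}n0.
Qed.

(** * Columns and rows treated uniformly as blocks *)

Section Blocks.
Context {m n r : nat}.
Variables (M : 'M[R]_(m, n)) (eps : R).
Implicit Types (x y : 'M[R]_(m, r) * 'M[R]_(r, n)) (b c : nmf_block r).

Definition block_kkt b x :=
  match b with
  | inl k => column_kkt M eps x.1 x.2 k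
  | inr k => column_kkt M^T eps x.2^T x.1^T k
  end.

Definition block_ge b x :=
  match b with
  | inl k => forall i, eps <= x.1 i k
  | inr k => forall j, eps <= x.2 k j
  end.

Lemma block_kkt_ge b x : block_kkt b x -> block_ge b x.
Proof.
by case: b => k kkt i; case: (kkt i) => //; rewrite mxE.
Qed.

Lemma hals_update_block_kkt b x y : hals_update M eps b x y -> block_kkt b y.
Proof.
case: x y b => [V W] [V' W'] [] k upd; first exact: hals_update_column_kkt upd.
exact: hals_update_column_kkt (hals_update_trmx upd).
Qed.

(** The updated block is feasible by its own KKT conditions; every other block is unchanged. *)
Lemma hals_update_block_ge b c x y :
  hals_update M eps b x y -> block_ge c x -> block_ge c y.
Proof.
move=> upd; have := block_kkt_ge (hals_update_block_kkt upd).
case: x y b c upd => [V W] [V' W'] [] k [] l /= [eqA eqB _] ge_k;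
  rewrite ?eqA //.
- have [->//|lk] := eqVneq l k.
  by move=> ge_l i; have /matrixP/(_ i 0) := eqB _ lk; rewrite !mxE => ->.
- have [->//|lk] := eqVneq l k.
  by move=> ge_l j; have /matrixP/(_ 0 j) := eqB _ lk; rewrite !mxE => ->.
Qed.

Lemma block_kkt_stationary V W :
  (forall b, block_kkt b (V, W)) -> stationary_point M eps V W.
Proof.
move=> kkt; rewrite /stationary_point.
rewrite gradient_objective_left gradient_objective_right.
split; split=> i j.
- by case: (kkt (inl j) i).
- by case: (kkt (inl j) i).
- by case: (kkt (inl j) i).
- by case: (kkt (inr i) j); rewrite /= mxE.
- by rewrite mxE; case: (kkt (inr i) j).
- by rewrite mxE; case: (kkt (inr i) j); rewrite /= mxE.
Qed.

End Blocks.

(** * Decrease of the objective in terms of single entries *)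

Section Decrease.
Context {m n r : nat}.
Variables (M : 'M[R]_(m, n)) (eps : R).
Implicit Types (V : 'M[R]_(m, r)) (W : 'M[R]_(r, n)).

Lemma hals_update_column_objective_le V V' W W' (k : 'I_r) :
  (forall i, eps <= V i k) -> hals_update M eps (inl k) (V, W) (V', W') ->
  nmf_objective M V' W' <= nmf_objective M V W.
Proof.
move=> V_ge upd; apply: le_trans (hals_update_column_decrease upd V_ge).
by rewrite lerDl mulr_ge0 // sumr_ge0 // => i _; rewrite sqr_ge0.
Qed.

(** Since [0 < n], row [k] of [W] has an entry, which is at least [eps], so the curvature is at
    least [eps ^+ 2]. Entries outside column [k] do not move. *)
Lemma hals_update_column_entry_decrease V V' W W' (k l : 'I_r) i :
  0 <= eps -> (0 < n)%N ->
  (forall i, eps <= V i k) -> (forall j, eps <= W k j) ->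
  hals_update M eps (inl k) (V, W) (V', W') ->
  nmf_objective M V' W' + eps ^+ 2 * (V i l - V' i l) ^+ 2 <=
  nmf_objective M V W.
Proof.
move=> eps_ge0 n_gt0 V_ge W_ge upd.
apply: le_trans (hals_update_column_decrease upd V_ge).
rewrite lerD2l mulrC; apply: ler_pM; rewrite ?sqr_ge0 //.
- have [->|lk] := eqVneq l k.
    by rewrite (bigD1 i) //= lerDl sumr_ge0 // => ? _; rewrite sqr_ge0.
  case: upd => _ eqV _; have /matrixP/(_ i 0) := eqV _ lk; rewrite !mxE => ->.
  by rewrite subrr expr0n sumr_ge0 // => ? _; rewrite sqr_ge0.
- rewrite (bigD1 (Ordinal n_gt0)) //= ler_wpDr //.
    by rewrite sumr_ge0 // => ? _; rewrite sqr_ge0.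
  by rewrite ler_sqr ?nnegrE // (le_trans eps_ge0).
Qed.

End Decrease.

(** Stated per entry to feed [step_cvg0_of_decrease]. The factor that is not updated has zero step,
    so monotonicity suffices for it; [0 < m] gives the curvature of row updates. *)
Lemma hals_update_entry_decrease m n r (M : 'M[R]_(m, n)) (eps : R)
    (b : nmf_block r) x y :
  0 <= eps -> (0 < m)%N -> (0 < n)%N -> (forall c, block_ge eps c x) ->
  hals_update M eps b x y ->
  (forall i k, nmf_objective M y.1 y.2 + eps ^+ 2 * (x.1 i k - y.1 i k) ^+ 2
     <= nmf_objective M x.1 x.2) /\
  (forall k j, nmf_objective M y.1 y.2 + eps ^+ 2 * (x.2 k j - y.2 k j) ^+ 2
     <= nmf_objective M x.1 x.2).
Proof.
case: x y b => [V W] [V' W'] [] k eps_ge0 m_gt0 n_gt0 x_ge upd /=.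
- have V_ge i : eps <= V i k := x_ge (inl k) i.
  split=> [i l|l j].
    by apply: hals_update_column_entry_decrease upd => //; exact: x_ge (inr k).
  have := hals_update_column_objective_le V_ge upd.
  by case: upd => -> _ _; rewrite subrr expr0n mulr0 addr0.
- have W_ge j : eps <= W^T j k by rewrite mxE; exact: x_ge (inr k) j.
  have updT := hals_update_trmx upd.
  rewrite -!(nmf_objective_trmx M); split=> [i l|l j].
    have := hals_update_column_objective_le W_ge updT.
    by case: upd => -> _ _; rewrite subrr expr0n mulr0 addr0.
  have V_ge i : eps <= V^T k i by rewrite mxE; exact: x_ge (inl k) i.
  have := hals_update_column_entry_decrease l j eps_ge0 m_gt0 W_ge V_ge updT.
  by rewrite !mxE.
Qed.

(** * The iterates under a cyclic order *)

Section Iterates.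
Context {m n r : nat}.
Variables (M : 'M[R]_(m, n)) (eps : R) (order : nat -> nmf_block r).
Variable x : nat -> 'M[R]_(m, r) * 'M[R]_(r, n).
Hypothesis order_cyclic : cyclic_order order.
Hypothesis x_hals : hals_iterates M eps order x.

(** The initial matrices are only positive, so the bound starts with an update of [b] in the first
    period; later updates preserve it. *)
Lemma hals_iterates_block_ge b t : (r + r <= t)%N -> block_ge eps b (x t).
Proof.
have [_ _ upd] := x_hals; have [_ /(_ b)[t0 t0_lt <-]] := order_cyclic.
move=> /(leq_trans t0_lt); elim: t => // t IHt.
rewrite ltnS leq_eqVlt => /predU1P[<-|/IHt]; last exact: hals_update_block_ge.
by apply: block_kkt_ge; apply: hals_update_block_kkt (upd t0).
Qed.

Lemma hals_iterates_step_cvg0 : 0 < eps -> (0 < m)%N -> (0 < n)%N ->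
  (forall i k, (x t).1 i k - (x t.+1).1 i k @[t --> \oo] --> 0) /\
  (forall k j, (x t).2 k j - (x t.+1).2 k j @[t --> \oo] --> 0).
Proof.
move=> eps_gt0 m_gt0 n_gt0; have [_ _ upd] := x_hals.
have obj_ge0 t : 0 <= nmf_objective M (x t).1 (x t).2 by exact: sqr_ge0.
have decr t (t_ge : (r + r <= t)%N) := hals_update_entry_decrease (ltW eps_gt0)
  m_gt0 n_gt0 (fun c => hals_iterates_block_ge c t_ge) (upd t).
have eps2_gt0 : 0 < eps ^+ 2 by rewrite exprn_gt0.
split=> i j; apply: (step_cvg0_of_decrease eps2_gt0 obj_ge0) => t t_ge.
  by have [/(_ i j)] := decr t t_ge.
by have [_ /(_ i j)] := decr t t_ge.
Qed.

Lemma cyclic_order_next b s :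
  exists t, [/\ (s <= t)%N, (t < s + (r + r) + (r + r))%N & order t = b].
Proof.
have [period /(_ b)[t0 t0_lt <-]] := order_cyclic.
have order_mul q : order (t0 + q * (r + r))%N = order t0.
  elim: q => [|q IHq]; first by rewrite mul0n addn0.
  by rewrite mulSn addnCA addnC period.
have r_gt0 : (0 < r + r)%N by case: (r + r)%N t0_lt.
(* The first multiple of the period beyond [s], plus the position [t0] of [b] in a period: less than
   two periods after [s]. *)
exists (t0 + (s %/ (r + r)).+1 * (r + r))%N; split; last exact: order_mul.
  by rewrite ltnW // ltn_addl // -ltn_divLR.
by rewrite mulSn; have := leq_divM s (r + r); lia.
Qed.

End Iterates.
End Convergence.

(** * Passage to the limit point *)

Unset Implicit Arguments.

Theorem theorem3 (R : realType) (m n r : nat) (M : 'M[R]_(m, n))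
    (M_ge0 : entrywise_ge 0 M) (r_ge1 : (1 <= r)%N)
    (eps : R) (eps_gt0 : 0 < eps)
    (order : nat -> nmf_block r) (order_cyclic : cyclic_order order)
    (x : nat -> 'M[R]_(m, r) * 'M[R]_(r, n))
    (x_hals : hals_iterates M eps order x)
    (V : 'M[R]_(m, r)) (W : 'M[R]_(r, n))
    (VW_limit : subsequential_limit x (V, W)) :
  stationary_point M eps V W.
Proof.
have [phi [phi_mono x_phi]] := VW_limit.
have phi_ge s : (s <= phi s)%N.
  by elim: s => // s IHs; apply: leq_ltn_trans IHs (phi_mono _ _ _).
have phi_oo : phi s @[s --> \oo] --> \oo.
  apply/cvgnyPge => A; near=> s; apply: leq_trans (phi_ge s); near: s.
  exact: nbhs_infty_ge.
have V_phi i k : (x (phi s)).1 i k @[s --> \oo] --> V i k.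
  have V_phi : (x (phi s)).1 @[s --> \oo] --> V.
    exact: cvg_comp x_phi (@cvg_fst _ _ _ _ _).
  exact: (cvg_comp _ (fun A : 'M[R]_(m, r) => A i k) V_phi
    (@coord_continuous _ _ _ _ _ _)).
have W_phi k j : (x (phi s)).2 k j @[s --> \oo] --> W k j.
  have W_phi : (x (phi s)).2 @[s --> \oo] --> W.
    exact: cvg_comp x_phi (@cvg_snd _ _ _ _ _).
  exact: (cvg_comp _ (fun A : 'M[R]_(r, n) => A k j) W_phi
    (@coord_continuous _ _ _ _ _ _)).
apply: block_kkt_stationary => b.
(* If [m] or [n] is 0 the steps need not vanish, but then the gradient conditions are trivial and
   only the lower bound has to pass to the limit. *)
have [/andP[m_gt0 n_gt0]|mn_empty] :=
  boolP ((0 < m)%N && (0 < n)%N); last first.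
  have ge_lim (u : nat -> R) l : (forall t, (r + r <= t)%N -> eps <= u t) ->
      u (phi s) @[s --> \oo] --> l -> eps <= l.
    move=> u_ge ul; rewrite -(cvg_lim _ ul) //; apply: limr_ge.
      by apply/cvg_ex; exists l.
    near=> s; apply: u_ge; apply: leq_trans (phi_ge s); near: s.
    exact: nbhs_infty_ge.
  have x_ge t := hals_iterates_block_ge order_cyclic x_hals b t.
  case: b x_ge => k x_ge;
    apply: column_kkt_of_empty; rewrite // 1?andbC // => i.
    by apply: ge_lim (V_phi i k) => t t_ge; exact: x_ge t t_ge i.
  by rewrite mxE; apply: ge_lim (W_phi k i) => t t_ge; exact: x_ge t t_ge i.
have [stepV stepW] :=
  hals_iterates_step_cvg0 order_cyclic x_hals eps_gt0 m_gt0 n_gt0.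
have /choice[psi psiP] := cyclic_order_next order_cyclic b.
(* Block [b] is updated at time [psi (phi s)]; its KKT conditions hold one index later, at the
   iterate produced by that update. *)
have near_phi s : (phi s <= (psi (phi s)).+1 <= phi s + ((r + r) + (r + r)))%N.
  by have [le_psi psi_lt _] := psiP (phi s); rewrite addnA psi_lt leqW.
have V_psi i k :=
  cvg_nearby_subsequence (stepV i k) phi_oo near_phi (V_phi i k).
have W_psi k j :=
  cvg_nearby_subsequence (stepW k j) phi_oo near_phi (W_phi k j).
have kkt_psi s : block_kkt M eps b (x (psi (phi s)).+1).
  have [_ _ <-] := psiP (phi s); have [_ _ upd] := x_hals.
  exact: hals_update_block_kkt (upd _).
case: b kkt_psi {psiP} => k kkt_psi.
  exact: column_kkt_lim kkt_psi V_psi W_psi.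
apply: column_kkt_lim kkt_psi _ _ => i j /=; rewrite mxE.
  by under eq_fun do rewrite mxE; exact: W_psi.
by under eq_fun do rewrite mxE; exact: V_psi.
Unshelve. all: by end_near.
Qed.
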